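(* Suppose that $\mu$ satisfies Assumption M and $h$ satisfies Assumption H (both stated in the context). Suppose there exists $((s^*,S^* ),w^*(\cdot),\gamma^* )$, where $s^*<S^*$ and $\gamma^*$ are real constants and $w^*:\mathbb{R}\to\mathbb{R}$ is continuously differentiable on $\mathbb{R}$ and twice continuously differentiable on $\mathbb{R}\setminus\{0\}$, such that $$\frac{\sigma^2}{2}(w^* )'(z)+\pi(w^*(z))-h(z)=\gamma^*\quad\text{for all } z\in\mathbb{R},$$ $$\int_{s^*}^{S^*}\big[w^*(z)-k\big]\,\mathrm{d}z=K,\qquad w^*(s^* )=w^*(S^* )=k,\qquad \lim_{z\to\infty}\frac{(w^* )'(z)}{h(z)}=0.$$ Then $$\lim_{z\to\infty}w^*(z)=-\infty,$$ and there exists a unique $z^*$ with $z^*\le0$ and $s^*<z^*<S^*$ such that $$\frac{\mathrm{d}w^*(z)}{\mathrm{d}z}\begin{cases}>0&\text{for } z<z^*,\\=0&\text{for } z=z^*,\\<0&\text{for } z>z^*.\end{cases}$$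
   Context: **Data.** Constants $\sigma>0$, $K>0$, $k>0$, $\bar p>\underline p\ge 0$; a function $\mu:[\underline p,\bar p]\to(0,\infty)$; a function $h:\mathbb{R}\to[0,\infty)$. **Assumption M.** (a) $\mu$ is twice continuously differentiable on $[\underline p,\bar p]$; (b) $\mu$ is strictly decreasing, with $\mu'(p)<0$. **Assumption H.** (a) $h$ has a minimum at $z=0$ and $h(0)=0$; (b) $h$ is continuously differentiable except at $z=0$; (c) $h$ is strictly convex; (d) there exist $c_1\in\mathbb R$, $c_2>0$ and a positive integer $n$ with $h(z)\le c_1+c_2|z|^n$ for all $z\in\mathbb R$. **Pricing functions.** For $p\in[\underline p,\bar p]$ and $w\in\mathbb R$, $\Pi(p,w)=\mu(p)(p-w)$; $p_\pi(w)=\min\operatorname{argmax}_{p\in[\underline p,\bar p]}\Pi(p,w)$ (the smallest maximizer); $\pi(w)=\Pi(p_\pi(w),w)=\mu(p_\pi(w))\,[p_\pi(w)-w]$. *)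

(* Defs.v *)
From Stdlib Require Import Reals Lra.
From Coquelicot Require Import Coquelicot.
Open Scope R_scope.

Definition Icc (a b x : R) : Prop := a <= x <= b.

(** [mu] is given as a total function, but only its values on [[a, b]] matter:
    [D_in] and [continue_in] are relative to the interval, so the derivatives
    at the endpoints are one-sided.  For [a < b], [D_in] determines [mu1] and
    [mu2] uniquely on [[a, b]]. *)
Definition assumption_M (a b : R) (mu : R -> R) : Prop :=
  (exists mu1 mu2 : R -> R,
      (forall p, Icc a b p ->
         D_in mu mu1 (Icc a b) p /\ D_in mu1 mu2 (Icc a b) p /\
         continue_in mu2 (Icc a b) p) /\
      (forall p, Icc a b p -> mu1 p < 0)) /\
  (forall p q, Icc a b p -> Icc a b q -> p < q -> mu q < mu p).

Definition strictly_convex (h : R -> R) : Prop :=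
  forall x y t, x <> y -> 0 < t < 1 ->
    h (t * x + (1 - t) * y) < t * h x + (1 - t) * h y.

Definition assumption_H (h : R -> R) : Prop :=
  ((forall z, h 0 <= h z) /\ h 0 = 0) /\
  (forall z, z <> 0 -> ex_derive h z /\ continuous (Derive h) z) /\
  strictly_convex h /\
  (exists (c1 c2 : R) (n : nat),
      0 < c2 /\ (0 < n)%nat /\ forall z, h z <= c1 + c2 * Rabs z ^ n).

Definition Profit (mu : R -> R) (p w : R) : R := mu p * (p - w).

Definition is_maximizer (a b : R) (mu : R -> R) (w p : R) : Prop :=
  Icc a b p /\ forall q, Icc a b q -> Profit mu q w <= Profit mu p w.

Definition is_min_maximizer (a b : R) (mu : R -> R) (w p : R) : Prop :=
  is_maximizer a b mu w p /\ forall q, is_maximizer a b mu w q -> p <= q.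

(** [iota] is definite description; [p_pi_correct] below shows that the
    described price exists and is unique under [assumption_M]. *)
Definition p_pi (a b : R) (mu : R -> R) (w : R) : R :=
  iota (is_min_maximizer a b mu w).

Definition max_profit (a b : R) (mu : R -> R) (w : R) : R :=
  Profit mu (p_pi a b mu w) w.

Lemma min_maximizer_exists (a b : R) (mu : R -> R) (w : R) :
  a <= b -> (forall p, Icc a b p -> continue_in mu (Icc a b) p) ->
  exists p, is_min_maximizer a b mu w p.
Proof.
intros Hab Hmu.
set (cl := fun x => Rmax a (Rmin b x)).
assert (clI : forall x, Icc a b (cl x)).
{ intros x; unfold cl, Icc, Rmax, Rmin; repeat destruct Rle_dec; lra. }
assert (clid : forall x, Icc a b x -> cl x = x).
{ intros x; unfold cl, Icc, Rmax, Rmin; repeat destruct Rle_dec; lra. }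
assert (cl1 : forall x y, Rabs (cl x - cl y) <= Rabs (x - y)).
{ intros x y; unfold cl, Rmax, Rmin, Rabs; repeat destruct Rle_dec;
  repeat destruct Rcase_abs; lra. }
assert (Ccl : forall x, continuity_pt cl x).
{ intros x e He; exists e; split; [exact He|]; intros y [_ Hy].
  simpl in *; unfold R_dist in *.
  apply Rle_lt_trans with (2 := Hy); apply cl1. }
assert (Cmu : forall x, continuity_pt (fun x => mu (cl x)) x).
{ intros x e He.
  destruct (Hmu _ (clI x) e He) as [d [Hd H]].
  exists d; split; [exact Hd|]; intros y [_ Hy].
  simpl in *; unfold R_dist in *.
  destruct (Req_dec (cl y) (cl x)) as [E|E].
  - rewrite E, Rminus_diag, Rabs_R0; exact He.
  - apply H; split; [split; [apply clI|exact (not_eq_sym E)]|].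
    apply Rle_lt_trans with (2 := Hy); apply cl1. }
set (g := fun x => Profit mu (cl x) w).
assert (Cg : forall x, continuity_pt g x).
{ intros x; unfold g, Profit.
  apply (continuity_pt_mult (fun x => mu (cl x)) (fun x => cl x - w)).
  - apply Cmu.
  - apply (continuity_pt_minus cl (fun _ => w)); [apply Ccl|].
    apply continuity_pt_const; intros ? ?; reflexivity. }
destruct (continuity_ab_maj g a b Hab (fun c _ => Cg c)) as [pm [Hpm Ipm]].
assert (Mpm : is_maximizer a b mu w pm).
{ split; [exact Ipm|]; intros q Hq.
  generalize (Hpm q Hq); unfold g; rewrite (clid q Hq), (clid pm Ipm); tauto. }
destruct (completeness (fun x => forall q, is_maximizer a b mu w q -> x <= q))
  as [m [Hub Hlub]].
{ exists pm; intros x Hx; apply Hx, Mpm. }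
{ exists a; intros q [[Hq _] _]; exact Hq. }
assert (Hm : forall q, is_maximizer a b mu w q -> m <= q).
{ intros q Hq; apply Hlub; intros x Hx; apply Hx, Hq. }
assert (Im : Icc a b m).
{ split.
  - apply Hub; intros q [[Hq _] _]; exact Hq.
  - apply Rle_trans with pm; [apply Hm, Mpm | apply Ipm]. }
exists m; split; [|exact Hm].
split; [exact Im|].
destruct (Rle_lt_dec (g pm) (g m)) as [L|L].
{ intros q Hq; apply Rle_trans with (Profit mu pm w); [apply Mpm, Hq|].
  revert L; unfold g; rewrite (clid m Im), (clid pm Ipm); tauto. }
exfalso.
destruct (Cg m (g pm - g m)) as [d [Hd H]]; [lra|].
assert (m + d <= m); [|lra].
apply Hub; intros q Hq.
destruct (Rle_lt_dec (m + d) q) as [|Lq]; [assumption|exfalso].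
assert (Eq : g q = g pm).
{ unfold g; rewrite (clid q (proj1 Hq)), (clid pm Ipm).
  apply Rle_antisym; [apply Mpm, Hq | apply Hq, Ipm]. }
destruct (Req_dec m q) as [E|E]; [subst; lra|].
assert (Hqm := Hm q Hq).
assert (D : R_dist (g q) (g m) < g pm - g m).
{ apply H; split; [split; [exact I|exact E]|].
  simpl; unfold R_dist; rewrite Rabs_pos_eq; lra. }
unfold R_dist in D; rewrite Eq, Rabs_pos_eq in D; lra.
Qed.

Lemma p_pi_correct (a b : R) (mu : R -> R) (w : R) :
  a <= b -> assumption_M a b mu ->
  is_min_maximizer a b mu w (p_pi a b mu w).
Proof.
intros Hab [[mu1 [mu2 [H _]]] _].
destruct (min_maximizer_exists a b mu w Hab) as [p Hp].
{ intros q Hq; apply cont_deriv with mu1; apply H, Hq. }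
apply (iota_correct (V := R_CompleteNormedModule) (is_min_maximizer a b mu w)).
exists p; split; [exact Hp|].
intros q Hq; apply Rle_antisym; [apply Hp, Hq | apply Hq, Hp].
Qed.

(* Main.v *)
Require Import Defs.
From Stdlib Require Import Reals Lra.
From Coquelicot Require Import Coquelicot.
Open Scope R_scope.

(** Solve the equation for the derivative: with [c = sigma ^ 2 / 2],
    [w' = G z w] where [G z x = (gamma + h z - pi x) / c].  The maximal profit
    [pi] is a supremum of the affine functions [w |-> mu p * (p - w)], whose
    slopes lie between [- mu p_lo] and [0]; hence [G] is nondecreasing and
    Lipschitz in [x] ([max_profit_slope]).  In [z] it varies as [h] does:
    strictly decreasing left of [0], strictly increasing right of it.

    The limit.  As [w'] is negligible against [h] at infinity, the equation
    makes [pi (w z)] at least [gamma + h z / 2], which is unbounded; [pi] being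
    nonincreasing, [w] must tend to minus infinity.

    The sign of [w'].  Where [G] increases in both arguments, a solution with
    [w' >= 0] at one point keeps [w' > 0] afterwards ([slope_stays_positive]):
    the solution stays above its starting value by a Gronwall argument, and then
    [G] has only grown.  On the right half-line this means that [w' >= 0]
    somewhere would force [w] to stay bounded below, against the limit; so
    [w' < 0] on [[0, +oo)].  On the left half-line the same lemma for [- w] says
    that [w' <= 0] somewhere forces [w' < 0] from there up to [0].  Thus [w'] has
    at most one zero, it is negative, and [w'] passes from positive to negative
    there.  The zero exists by Rolle, since [w s_st = w S_st]. *)

(** * Monotone differential equations *)

(** Only points left of [y] are compared, so this applies also to a minimum
    attained at the right end of an interval. *)
Lemma minimum_left_slope (v : R -> R) (a y l : R) :
  a < y -> (forall x, a <= x <= y -> v y <= v x) -> is_derive v y l -> l <= 0.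
Proof.
intros Hay Hmin Hd.
destruct (Rle_lt_dec l 0) as [|Hl]; [assumption|exfalso].
apply is_derive_Reals in Hd.
destruct (Hd l Hl) as [[d Hd0] H]; simpl in H.
set (e := Rmin (d / 2) (y - a)).
assert (He : 0 < e) by (unfold e; apply Rmin_glb_lt; lra).
assert (He1 : e <= d / 2) by apply Rmin_l.
assert (He2 : e <= y - a) by apply Rmin_r.
assert (H1 : Rabs ((v (y + - e) - v y) / - e - l) < l).
{ apply H; [lra|]; rewrite Rabs_Ropp, Rabs_pos_eq; lra. }
apply Rabs_def2 in H1.
assert (H2 : v y <= v (y + - e)) by (apply Hmin; lra).
assert (H3 : (v (y + - e) - v y) / - e <= 0); [|lra].
replace ((v (y + - e) - v y) / - e) with (- ((v (y + - e) - v y) / e))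
  by (field; lra).
assert (0 <= (v (y + - e) - v y) / e); [|lra].
apply Rmult_le_pos; [lra|]; apply Rlt_le, Rinv_0_lt_compat, He.
Qed.

(** At a point after [a] where [w < w a], the monotonicity in [z] and the
    Lipschitz bound give [w' > - L * (w a - w)], so the weighted gap
    [exp (- L * z) * (w z - w a)] has a positive derivative there.  Hence this
    gap, which starts at [0], cannot attain a negative minimum. *)
Lemma solution_stays_above_start (G : R -> R -> R) (w : R -> R) (L a b : R) :
  (forall z x, a < z <= b -> G a x < G z x) ->
  (forall z x y, x <= y -> 0 <= G z y - G z x <= L * (y - x)) ->
  (forall z, a <= z <= b -> is_derive w z (G z (w z))) ->
  0 <= G a (w a) -> a <= b -> w a <= w b.
Proof.
intros Hz Hx Hw Ha Hab.
destruct (Rle_lt_dec (w a) (w b)) as [|Hlt]; [assumption|exfalso].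
set (v := fun z => exp (- L * z) * (w z - w a)).
assert (Hv : forall z, a <= z <= b ->
  is_derive v z (exp (- L * z) * (G z (w z) + L * (w a - w z)))).
{ intros z Iz; unfold v.
  assert (Dw := is_derive_unique _ _ _ (Hw z Iz)).
  auto_derive; [exists (G z (w z)); exact (Hw z Iz)|].
  change (Derive (fun x => w x) z) with (Derive w z).
  rewrite Dw; ring. }
destruct (continuity_ab_min v a b Hab) as [y [Hy Iy]].
{ intros z Iz; apply derivable_continuous_pt.
  eexists; apply is_derive_Reals; exact (Hv z Iz). }
assert (vneg : v y < 0).
{ apply Rle_lt_trans with (v b); [apply Hy; lra|]; unfold v.
  assert (E := exp_pos (- L * b)); nra. }
assert (wy : w y < w a).
{ unfold v in vneg; assert (E := exp_pos (- L * y)).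
  destruct (Rlt_le_dec (w y) (w a)) as [|?]; [assumption|]; nra. }
assert (ay : a < y).
{ destruct (Req_dec a y) as [E|]; [rewrite E in wy|]; lra. }
assert (S : exp (- L * y) * (G y (w y) + L * (w a - w y)) <= 0).
{ apply (minimum_left_slope v a y); [exact ay| |apply Hv, Iy].
  intros x Ix; apply Hy; lra. }
assert (G1 := Hz y (w a) (conj ay (proj2 Iy))).
assert (G2 := Hx y (w y) (w a) (Rlt_le _ _ wy)).
assert (E := exp_pos (- L * y)); nra.
Qed.

Lemma slope_stays_positive (G : R -> R -> R) (w : R -> R) (L a b : R) :
  (forall z x, a < z <= b -> G a x < G z x) ->
  (forall z x y, x <= y -> 0 <= G z y - G z x <= L * (y - x)) ->
  (forall z, a <= z <= b -> is_derive w z (G z (w z))) ->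
  0 <= G a (w a) -> a < b -> 0 < G b (w b).
Proof.
intros Hz Hx Hw Ha Hab.
assert (H := solution_stays_above_start G w L a b Hz Hx Hw Ha (Rlt_le _ _ Hab)).
assert (G1 := Hz b (w a) (conj Hab (Rle_refl b))).
assert (G2 := Hx b _ _ H); lra.
Qed.

(** * The maximal profit *)

(** The revealed-preference form of the envelope theorem: using the optimal
    price for one cost at the other cost bounds the change of the maximal
    profit from either side. *)
Lemma max_profit_slope (a b : R) (mu : R -> R) (x y : R) :
  a <= b -> (forall p, Icc a b p -> 0 < mu p) -> assumption_M a b mu ->
  x <= y ->
  0 <= max_profit a b mu x - max_profit a b mu y <= mu a * (y - x).
Proof.
intros Hab Hmu HM Hxy.
destruct (p_pi_correct a b mu x Hab HM) as [[Ip Hp] _].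
destruct (p_pi_correct a b mu y Hab HM) as [[Iq Hq] _].
unfold max_profit.
set (p := p_pi a b mu x) in *; set (q := p_pi a b mu y) in *.
assert (H1 := Hp q Iq); assert (H2 := Hq p Ip).
assert (M1 : mu p <= mu a).
{ destruct (Req_dec a p) as [E|E]; [rewrite <- E; lra|].
  apply Rlt_le; apply (proj2 HM); [split; lra|exact Ip|].
  destruct Ip; lra. }
assert (M2 := Hmu q Iq).
unfold Profit in *; split; nra.
Qed.

(** * The shape of the holding cost *)

Lemma strictly_convex_below_chord (h : R -> R) (t y : R) :
  strictly_convex h -> h 0 = 0 -> y <> 0 -> 0 < t < 1 -> h (t * y) < t * h y.
Proof.
intros Hc H0 Hy Ht.
assert (H := Hc y 0 t Hy Ht).
rewrite H0 in H; replace (t * y + (1 - t) * 0) with (t * y) in H by ring; lra.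
Qed.

Lemma strictly_convex_pos (h : R -> R) (y : R) :
  strictly_convex h -> h 0 = 0 -> (forall z, 0 <= h z) -> y <> 0 -> 0 < h y.
Proof.
intros Hc H0 Hp Hy.
assert (H := strictly_convex_below_chord h (1 / 2) y Hc H0 Hy ltac:(lra)).
assert (H1 := Hp (1 / 2 * y)); lra.
Qed.

Lemma strictly_convex_increases_from_0 (h : R -> R) (t y : R) :
  strictly_convex h -> h 0 = 0 -> (forall z, 0 <= h z) -> y <> 0 ->
  0 <= t < 1 -> h (t * y) < h y.
Proof.
intros Hc H0 Hp Hy Ht.
assert (P := strictly_convex_pos h y Hc H0 Hp Hy).
destruct (Req_dec t 0) as [->|E]; [rewrite Rmult_0_l, H0; exact P|].
assert (H := strictly_convex_below_chord h t y Hc H0 Hy ltac:(lra)); nra.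
Qed.

Lemma strictly_convex_increasing_right (h : R -> R) (x y : R) :
  strictly_convex h -> h 0 = 0 -> (forall z, 0 <= h z) -> 0 <= x < y ->
  h x < h y.
Proof.
intros Hc H0 Hp Hxy.
replace x with (x / y * y) by (field; lra).
apply strictly_convex_increases_from_0; [assumption..|lra|].
split; [apply Rmult_le_pos; [lra|]; apply Rlt_le, Rinv_0_lt_compat; lra|].
apply Rmult_lt_reg_r with y; [lra|].
replace (x / y * y) with x by (field; lra); lra.
Qed.

Lemma strictly_convex_decreasing_left (h : R -> R) (x y : R) :
  strictly_convex h -> h 0 = 0 -> (forall z, 0 <= h z) -> x < y <= 0 ->
  h y < h x.
Proof.
intros Hc H0 Hp Hxy.
assert (H := strictly_convex_increasing_right (fun z => h (- z)) (- y) (- x)).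
simpl in H; rewrite !Ropp_involutive in H; apply H; [|now rewrite Ropp_0| |lra].
- intros u v t Huv Ht.
  replace (- (t * u + (1 - t) * v)) with (t * - u + (1 - t) * - v) by ring.
  apply Hc; [lra|exact Ht].
- intros z; apply Hp.
Qed.

Lemma strictly_convex_linear_growth (h : R -> R) (y : R) :
  strictly_convex h -> h 0 = 0 -> 1 < y -> y * h 1 < h y.
Proof.
intros Hc H0 Hy.
assert (Hi : 0 < / y < 1).
{ split; [apply Rinv_0_lt_compat; lra|].
  rewrite <- Rinv_1; apply Rinv_lt_contravar; lra. }
assert (H := strictly_convex_below_chord h (/ y) y Hc H0 ltac:(lra) Hi).
rewrite Rinv_l in H by lra.
apply Rmult_lt_compat_l with (r := y) in H; [|lra].
replace (y * (/ y * h y)) with (h y) in H by (field; lra); exact H.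
Qed.

(** * The solution *)

(** Eventually [c * w' <= h / 2], so [pi (w z) >= gamma + h z / 2] exceeds every
    value [pi M]; then [w z < M] because [pi] is nonincreasing. *)
Lemma solution_tends_to_m_infty (h w pi : R -> R) (c gamma : R) :
  0 < c -> strictly_convex h -> h 0 = 0 -> (forall z, 0 <= h z) ->
  (forall x y, x <= y -> pi y <= pi x) ->
  (forall z, c * Derive w z + pi (w z) - h z = gamma) ->
  is_lim (fun z => Derive w z / h z) p_infty 0 ->
  is_lim w p_infty m_infty.
Proof.
intros Hc Hcv H0 Hp Hpi Hode Hlim.
apply is_lim_spec; intros M; simpl.
apply is_lim_spec in Hlim.
assert (He : 0 < / (2 * c)) by (apply Rinv_0_lt_compat; lra).
destruct (Hlim (mkposreal _ He)) as [Z HZ]; simpl in HZ.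
assert (P1 := strictly_convex_pos h 1 Hcv H0 Hp ltac:(lra)).
(* [h z > z * h 1 >= B * h 1 = 2 * (pi M - gamma)] for [z] beyond [B] *)
set (B := 2 * (pi M - gamma) / h 1).
exists (Rmax Z (Rmax 1 B)); intros z Hz.
assert (Z1 := Rmax_l Z (Rmax 1 B)); assert (Z2 := Rmax_r Z (Rmax 1 B)).
assert (Z3 := Rmax_l 1 B); assert (Z4 := Rmax_r 1 B).
assert (G1 := strictly_convex_linear_growth h z Hcv H0 ltac:(lra)).
assert (G2 : 2 * (pi M - gamma) < h z).
{ apply Rle_lt_trans with (2 := G1).
  replace (2 * (pi M - gamma)) with (B * h 1) by (unfold B; field; lra).
  apply Rmult_le_compat_r; lra. }
assert (P := strictly_convex_pos h z Hcv H0 Hp ltac:(lra)).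
assert (D := HZ z ltac:(lra)); rewrite Rminus_0_r in D.
apply Rabs_def2 in D; destruct D as [D _].
assert (D1 : c * Derive w z < h z / 2).
{ replace (c * Derive w z) with (Derive w z / h z * (c * h z)) by (field; lra).
  replace (h z / 2) with (/ (2 * c) * (c * h z)) by (field; lra).
  apply Rmult_lt_compat_r; [apply Rmult_lt_0_compat|]; lra. }
destruct (Rlt_le_dec (w z) M) as [|L]; [assumption|exfalso].
assert (L1 := Hpi _ _ L); assert (O := Hode z); lra.
Qed.

Theorem proposition5p1 :
  forall (sigma K k p_lo p_hi : R) (mu h : R -> R),
    0 < sigma -> 0 < K -> 0 < k -> 0 <= p_lo -> p_lo < p_hi ->
    (forall p, Icc p_lo p_hi p -> 0 < mu p) ->
    (forall z, 0 <= h z) ->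
    assumption_M p_lo p_hi mu ->
    assumption_H h ->
  forall (s_st S_st : R) (w : R -> R) (gamma : R),
    s_st < S_st ->
    (forall z, ex_derive w z /\ continuous (Derive w) z) ->
    (forall z, z <> 0 -> ex_derive_n w 2 z /\ continuous (Derive_n w 2) z) ->
    (forall z,
       sigma ^ 2 / 2 * Derive w z + max_profit p_lo p_hi mu (w z) - h z = gamma) ->
    is_RInt (fun z => w z - k) s_st S_st K ->
    w s_st = k -> w S_st = k ->
    is_lim (fun z => Derive w z / h z) p_infty 0 ->
  is_lim w p_infty m_infty /\
  exists! z_st : R,
    (z_st <= 0 /\ s_st < z_st < S_st) /\
    (forall z, z < z_st -> Derive w z > 0) /\
    Derive w z_st = 0 /\
    (forall z, z_st < z -> Derive w z < 0).
Proof.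
intros sigma K k p_lo p_hi mu h Hsigma _ _ _ Hp Hmu Hh HM HH
  s S w gamma HsS Hw _ Hode _ Hs HS Hlim.
destruct HH as [[_ H0] [_ [Hcv _]]].
assert (Hslope := fun x y => max_profit_slope p_lo p_hi mu x y
  (Rlt_le _ _ Hp) Hmu HM).
set (pi := max_profit p_lo p_hi mu) in *.
set (c := sigma ^ 2 / 2) in *.
assert (Hc : 0 < c) by (unfold c; assert (0 < sigma ^ 2) by nra; lra).
assert (Hci := Rinv_0_lt_compat _ Hc).
assert (Hinf : is_lim w p_infty m_infty).
{ apply (solution_tends_to_m_infty h w pi c gamma); try assumption.
  intros x y Hxy; assert (X := Hslope x y Hxy); lra. }
split; [exact Hinf|].
set (G := fun z x => (gamma + h z - pi x) * / c).
assert (HG : forall z, Derive w z = G z (w z)).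
{ intros z; unfold G; rewrite <- (Hode z); field; lra. }
assert (Dw : forall z, is_derive w z (G z (w z))).
{ intros z; rewrite <- HG; apply Derive_correct, Hw. }
assert (GL : forall z x y, x <= y ->
  0 <= G z y - G z x <= mu p_lo * / c * (y - x)).
{ intros z x y Hxy; destruct (Hslope x y Hxy) as [X1 X2]; unfold G.
  replace ((gamma + h z - pi y) * / c - (gamma + h z - pi x) * / c)
    with ((pi x - pi y) * / c) by ring.
  replace (mu p_lo * / c * (y - x)) with (mu p_lo * (y - x) * / c) by ring.
  split; [apply Rmult_le_pos|apply Rmult_le_compat_r]; lra. }
assert (Hright : forall z, 0 <= z -> Derive w z < 0).
{ intros z Hz; destruct (Rlt_le_dec (Derive w z) 0) as [|D];
    [assumption|exfalso].
  assert (Hup : forall b, z <= b -> w z <= w b).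
  { intros b Hb.
    apply (solution_stays_above_start G w (mu p_lo * / c)); auto.
    - intros t x Ht; unfold G; apply Rmult_lt_compat_r; [exact Hci|].
      assert (X := strictly_convex_increasing_right h z t Hcv H0 Hh
        ltac:(lra)); lra.
    - rewrite <- HG; exact D. }
  apply is_lim_spec in Hinf; destruct (Hinf (w z)) as [Z HZ].
  set (b := Rmax Z z + 1).
  assert (Z1 := Rmax_l Z z); assert (Z2 := Rmax_r Z z).
  assert (X1 := HZ b ltac:(unfold b; lra)).
  assert (X2 := Hup b ltac:(unfold b; lra)); lra. }
assert (Hleft : forall a b, Derive w a <= 0 -> a < b <= 0 -> Derive w b < 0).
{ intros a b Da Hab.
  (* [- w] solves the equation whose right-hand side is [- G z (- x)] *)
  assert (X : 0 < - G b (- - w b)).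
  { apply (slope_stays_positive (fun z x => - G z (- x)) (fun z => - w z)
      (mu p_lo * / c) a b); [| | | |lra].
    - intros z x Hz; apply Ropp_lt_contravar; unfold G.
      apply Rmult_lt_compat_r; [exact Hci|].
      assert (X := strictly_convex_decreasing_left h a z Hcv H0 Hh
        ltac:(lra)); lra.
    - intros z x y Hxy; assert (X := GL z (- y) (- x) ltac:(lra)).
      replace (- x - - y) with (y - x) in X by ring; lra.
    - intros z _; rewrite Ropp_involutive; apply (is_derive_opp w), Dw.
    - rewrite Ropp_involutive, <- HG; lra. }
  rewrite Ropp_involutive, <- HG in X; lra. }
destruct (MVT_cor2 w (Derive w) s S HsS) as [z0 [E Iz]].
{ intros z _; apply is_derive_Reals, Derive_correct, Hw. }
assert (Dz : Derive w z0 = 0).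
{ rewrite Hs, HS in E; nra. }
assert (Nz : z0 < 0).
{ destruct (Rlt_le_dec z0 0) as [|N]; [assumption|].
  assert (X := Hright z0 N); lra. }
exists z0; split.
- split; [lra|]; split; [|split; [exact Dz|]].
  + intros z Hz; destruct (Rle_lt_dec (Derive w z) 0) as [D|]; [|lra].
    assert (X := Hleft z z0 D ltac:(lra)); lra.
  + intros z Hz; destruct (Rle_lt_dec z 0) as [N|P].
    * apply (Hleft z0 z); lra.
    * apply Hright; lra.
- intros z' [_ [Hpos [_ Hneg]]].
  destruct (Rtotal_order z0 z') as [T|[T|T]]; [|exact T|].
  + assert (X := Hpos _ T); lra.
  + assert (X := Hneg _ T); lra.
Qed.
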